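(* Let $q$ be an odd prime power and let $K=K(g)$ be integers with $\log g\cdot\log_q g\le K$ and $K=o(g)$ as $g\to\infty$. Then, for $D\in\mathbb{F}_q[x]$ monic square-free of degree $2g+1$, almost all zeros of $\mathcal{F}_K(u,\chi_D)$ are simple: the number of distinct zeros of $\mathcal{F}_K(u,\chi_D)$ is at least $2g(1+o(1))$ while the number of its multiple zeros is $o(g)$, as $g\to\infty$.
   Context: $\chi_D(f)=(D/f)$ is the quadratic character (Jacobi symbol) on $\mathbb{F}_q[x]$. $\Lambda(f)=\deg P$ if $f=P^n$ with $P$ monic irreducible, $n\ge1$, else $0$; $P_K(u,\chi_D)=\exp\big(\sum_{k=1}^{K}\sum_{f\ \mathrm{monic},\ \deg f=k}\Lambda(f)\chi_D(f)u^k/k\big)$; $\mathcal{F}_K(u,\chi_D)=\tfrac12(P_K(u,\chi_D)+(qu^2)^gP_K(\overline u,\chi_D))$, whose zeros all lie on $|u|=q^{-1/2}$. A zero $q^{-1/2}e(\theta)$ of $\mathcal{F}_K$ is simple if $\frac{d}{d\theta}\mathcal{F}_K(q^{-1/2}e(\theta),\chi_D)\ne0$ there. $e(x)=e^{2\pi ix}$. *)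

(* Defs.v *)
From HB Require Import structures.
From mathcomp Require Import all_boot all_order all_algebra.
From mathcomp Require Export qpoly.
From mathcomp Require Export complex.
From mathcomp Require Import all_classical all_reals all_analysis.

Set Implicit Arguments.
Unset Strict Implicit.
Unset Printing Implicit Defensive.

Import Order.TTheory GRing.Theory Num.Theory.
Import numFieldNormedType.Exports.

Local Open Scope classical_set_scope.
Local Open Scope ring_scope.
Local Open Scope complex_scope.

Section PolynomialArithmetic.
Variable F : finFieldType.
Implicit Types f P D : {poly F}.

Definition squarefree_poly D := forall P, (1 < size P)%N -> ~~ (P ^+ 2 %| D).

Definition monic_irr P := (P \is monic) && irreducibleb P.

Definition legendre D P : int :=
  if P %| D then 0
  else if `[< exists a : {poly F}, P %| a ^+ 2 - D >] then 1 else -1.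

(* The exact power of P in f, for f != 0 and P nonconstant: then P ^+ e %| f
   forces e <= deg f < size f. *)
Definition multiplicity P f : nat :=
  (\max_(e < size f | (P ^+ e %| f)%R) e)%N.

(* For f monic; every prime factor of f has size at most size f. *)
Definition jacobi D f : int :=
  \prod_(P : {poly_(size f) F} | monic_irr P) legendre D P ^+ multiplicity P f.

Definition mangoldt f : nat :=
  if [pick P : {poly_(size f) F} |
        monic_irr P && `[< exists2 n, (0 < n)%N & f = (P : {poly F}) ^+ n >]]
  is Some P then (size P).-1 else 0%N.

End PolynomialArithmetic.

Section TruncatedProduct.
Variable R : realType.
Implicit Types (z u : R[i]) (t : R).

Definition cexp z : R[i] :=
  (expR (complex.Re z))%:C * (cos (complex.Im z) +i* sin (complex.Im z)).

Definition e2pi t : R[i] := cexp ((2 * pi * t)%:C * 'i).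

(* Derivative of a complex-valued function of a real variable; R[i] is not a
   normed R-module in the library, and its norm topology is carried by R[i]^o. *)
Definition is_deriv_R (phi : R -> R[i]) t (l : R[i]) :=
  (((phi (t + h) - phi t) / h%:C : R[i]^o) @[h --> (0 : R)^'] --> (l : R[i]^o)).

Variable F : finFieldType.
Implicit Type D : {poly F}.

Definition PK (K : nat) D u : R[i] :=
  cexp (\sum_(1 <= k < K.+1)
          \sum_(f : {poly_k.+1 F} | ((f : {poly F}) \is monic)
                                    && (size f == k.+1))
            (mangoldt f)%:R * (jacobi D f)%:~R * u ^+ k / k%:R).

Definition FK (K g : nat) D u : R[i] :=
  2^-1 * (PK K D u + (#|F|%:R * u ^+ 2) ^+ g * PK K D u^*).

Definition circle_pt t : R[i] := ((Num.sqrt #|F|%:R)^-1)%:C * e2pi t.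

Definition zeros (K g : nat) D : set R[i] := [set u | FK K g D u = 0].

Definition simple_zeros (K g : nat) D : set R[i] :=
  [set u | zeros K g D u /\
     exists t l, [/\ u = circle_pt t,
                     is_deriv_R (FK K g D \o circle_pt) t l & l != 0]].

Definition multiple_zeros (K g : nat) D : set R[i] :=
  zeros K g D `\` simple_zeros K g D.

End TruncatedProduct.

Arguments zeros R {F} K g D.
Arguments simple_zeros R {F} K g D.
Arguments multiple_zeros R {F} K g D.

(* Main.v *)
(* Writing [w = sqrt q * u] and [log P_K(u) = p(w)], where [p] is a polynomial of
   degree at most [K] with real coefficients, turns [F_K(u)] into
   [(exp p(w) + w ^ 2g * conj (exp p(w))) / 2], whose zeros lie on [|w| = 1]
   because the two terms must have the same modulus. At [w = exp (i x)] this is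
   [exp (i g x) * |exp p(w)| * cos (phase x)] with [phase x = g x - Im p(w)].
   The phase grows by [2 pi g] over a period, so its cosine vanishes at least
   [2 g] times. A zero is multiple only if [phase' x = 0]; as [phase'] is a
   trigonometric polynomial of degree at most [K] and mean value [g != 0], this
   happens at no more than [2 K = o(g)] points. *)

Require Import Defs.
From mathcomp Require Import all_boot all_order all_algebra finmap.
From mathcomp Require Import all_classical all_reals all_analysis.
From mathcomp Require Import ring lra.
Set Implicit Arguments.
Unset Strict Implicit.
Unset Printing Implicit Defensive.
Import Order.TTheory GRing.Theory Num.Theory.
Import numFieldNormedType.Exports.
Local Open Scope classical_set_scope.
Local Open Scope card_scope.
Local Open Scope ring_scope.
Local Open Scope complex_scope.

Section Cardinality.

Lemma card_le_inj T U (A : set T) (B : set U) (f : T -> U) :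
  {in A &, injective f} -> f @` A `<=` B -> A #<= B.
Proof.
by move=> /inj_card_eq fA fAB; rewrite -(card_le_eql fA) subset_card_le.
Qed.

Lemma finite_roots (L : idomainType) (p : {poly L}) :
  p != 0 -> finite_set [set x | root p x].
Proof.
move=> p0; apply: contrapT => /(infinite_set_fset (size p)) [B Bp sB].
have /(max_poly_roots p0)/(_ (fset_uniq B)) : all (root p) B.
  by apply/allP => x /Bp.
by rewrite ltnNge sB.
Qed.

Lemma card_roots_le (L : idomainType) (p : {poly L}) :
  p != 0 -> [set x | root p x] #<= `I_(size p).-1.
Proof.
move=> p0; have fin := finite_roots p0; have /finite_setP[n An] := fin.
rewrite (card_le_eql An) card_le_II -(card_fset_set An).
rewrite -ltnS prednK ?size_poly_gt0//; apply: max_poly_roots (fset_uniq _) => //.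
by apply/allP => x; rewrite in_fset_set// inE.
Qed.

Lemma finite_separated_set (R : archiRealFieldType) (A : set R) (a b d : R) :
  0 < d -> A `<=` `[a, b] ->
  (forall x y, A x -> A y -> `|x - y| < d -> x = y) -> finite_set A.
Proof.
move=> d0 Aab sep; pose n x := Num.truncn ((x - a) / d).
have itvn x : A x -> d * (n x)%:R <= x - a < d * (n x)%:R + d.
  move=> /Aab; rewrite /= in_itv /= => /andP[ax _].
  have := @truncn_itv _ ((x - a) / d); rewrite divr_ge0 ?subr_ge0 ?(ltW d0)//.
  rewrite -/(n x) -natr1 ler_pdivlMr// ltr_pdivrMr// mulrDl mul1r mulrC.
  exact.
apply: (card_le_finite (B := `I_(Num.truncn ((b - a) / d)).+1)) => //.
apply: (card_le_inj (f := n)).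
  move=> x y; rewrite !inE => Ax Ay nxy; apply: sep => //.
  have /andP[x1 x2] := itvn x Ax; have /andP[y1 y2] := itvn y Ay.
  by rewrite nxy in x1 x2; rewrite ltr_norml; apply/andP; split; lra.
move=> _ [x /Aab + <-]; rewrite /= in_itv /= => /andP[_ xb].
by rewrite ltnS le_truncn// ler_pM2r ?invr_gt0// lerD2r.
Qed.

End Cardinality.

Section UnitCircle.
Variable R : realType.
Implicit Types (x y : R) (w z : R[i]).

Definition cis x : R[i] := cos x +i* sin x.

Lemma cis0 : cis 0 = 1.
Proof. by rewrite /cis cos0 sin0. Qed.

Lemma cisD x y : cis (x + y) = cis x * cis y.
Proof. by rewrite /cis cosD sinD; simpc; congr (_ +i* _); rewrite addrC. Qed.

Lemma cisMn n x : cis (n%:R * x) = cis x ^+ n.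
Proof.
elim: n => [|n IHn]; first by rewrite mul0r cis0 expr0.
by rewrite -natr1 mulrDl mul1r cisD IHn exprSr.
Qed.

Lemma cisJ x : (cis x)^*%C = cis (- x).
Proof. by rewrite /cis cosN sinN. Qed.

Lemma cis2pi : cis (2 * pi) = 1.
Proof. by rewrite /cis mulr_natl cos2pi sin2pi. Qed.

Lemma norm_cis x : `|cis x| = 1.
Proof. by rewrite normc_def /= cos2Dsin2 sqrtr1. Qed.

Lemma cis_neq0 x : cis x != 0.
Proof. by rewrite -normr_gt0 norm_cis. Qed.

Lemma addr_cisN x : cis x + cis (- x) = (2 * cos x)%:C.
Proof. by rewrite -cisJ addcJ rmorphM rmorph_nat. Qed.

Lemma sin_eq0_small x : `|x| < pi -> sin x = 0 -> x = 0.
Proof.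
move=> xpi sx0; apply/eqP; apply/negPn/negP => x0.
have : 0 < sin `|x| by apply: sin_gt0_pi; rewrite normr_gt0 x0.
by case: (ger0P x) => _; rewrite ?sinN sx0 ?oppr0 ltxx.
Qed.

Lemma cos_eq1_small x : `|x| < 2 * pi -> cos x = 1 -> x = 0.
Proof.
move=> x2pi cx; rewrite -[x](divfK (x := 2))//; apply/eqP.
rewrite mulf_eq0 pnatr_eq0 orbF; apply/eqP/sin_eq0_small.
  by rewrite normrM (gtr0_norm (x := 2^-1)) ?invr_gt0// ltr_pdivrMr// mulrC.
have := cos_mulr2n (x / 2); rewrite -(mulr_natr (x / 2)) divfK// cx cos2sin2 => s0.
by apply/eqP; rewrite -sqrf_eq0; apply/eqP; lra.
Qed.

Lemma cis_inj_small x y : `|x - y| < 2 * pi -> cis x = cis y -> x = y.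
Proof.
move=> xy cxy; apply/eqP; rewrite -subr_eq0; apply/eqP/cos_eq1_small => //.
by have [] : cis (x - y) = 1 by rewrite cisD cxy -cisD subrr cis0.
Qed.

Lemma cis_inj : {in `[0, 2 * pi[ &, injective cis}.
Proof.
move=> x y; rewrite !in_itv /= => /andP[x0 x2] /andP[y0 y2].
by apply: cis_inj_small; rewrite ltr_norml; apply/andP; split; lra.
Qed.

Lemma unit_circle_cis w : `|w| = 1 -> exists2 x, x \in `[0, 2 * pi[ & w = cis x.
Proof.
case: w => a b /(congr1 (fun z => z ^+ 2)); rewrite -add_Re2_Im2 expr1n /=.
move=> /complexI ab1; have pi0 := pi_gt0 R.
have a1 : -1 <= a <= 1 by apply/andP; split; have := sqr_ge0 b; nra.
have [/andP[t0 tpi] ct] := acos_def a1.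
have st : sin (acos a) = `|b|.
  by rewrite sin_acos// -ab1 addrAC subrr add0r sqrtr_sqr.
have [b0|b0] := ger0P b.
  exists (acos a); first by rewrite in_itv /= t0; lra.
  by rewrite /cis ct st ger0_norm.
have t_gt0 : 0 < acos a.
  rewrite lt_neqAle t0 andbT; apply/eqP => t00; move: st.
  by rewrite -t00 sin0 => /esym/eqP; rewrite normr_eq0 lt_eqF.
exists (2 * pi - acos a); first by rewrite in_itv /=; apply/andP; split; lra.
by rewrite cisD cis2pi mul1r -cisJ /cis /= ct st ltr0_norm// opprK.
Qed.

Lemma cexpE z : cexp z = (expR (complex.Re z))%:C * cis (complex.Im z).
Proof. by []. Qed.

Lemma cexpJ z : cexp z^*%C = (cexp z)^*%C.
Proof. by case: z => a b; rewrite !cexpE /= /cis cosN sinN; simpc. Qed.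

Lemma cexp_neq0 z : cexp z != 0.
Proof. by rewrite cexpE mulf_neq0 ?cis_neq0// fmorph_eq0 gt_eqF ?expR_gt0. Qed.

Lemma e2piE x : e2pi x = cis (2 * pi * x).
Proof. by rewrite /e2pi /cexp; simpc; rewrite expR0; simpc. Qed.

End UnitCircle.

Arguments cis {R} x.

Section ZerosOfCosComp.
Variable R : realType.
Implicit Types (f : R -> R) (a b c v x y : R) (n : nat).

(* By Rolle, two points of the level set are separated by a critical point, so
   that a point is determined by the number of critical points on its left. *)
Lemma finite_level_set f a b v :
  (forall x, x \in `[a, b] -> derivable f x 1) ->
  finite_set (`]a, b[ `&` [set c : R | is_derive c 1 f 0]) ->
  finite_set (`[a, b] `&` [set x | f x = v]).
Proof.
move=> df finC; set C := (X in finite_set X) in finC.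
set A := (X in finite_set X).
pose below x := [fset c in fset_set C | c < x]%fset.
have below_lt x y : A x -> A y -> x < y -> (#|` below x| < #|` below y|)%N.
  move=> [+ fx] [+ fy] xy; rewrite /= !in_itv /= => /andP[ax xb] /andP[ay yb].
  have df_xy z : x <= z <= y -> derivable f z 1.
    by move=> xzy; apply: df; rewrite in_itv /=; apply/andP; split; lra.
  have [|||c] := @Rolle R f x y xy.
  - by move=> z; rewrite in_itv /= => xzy; apply: df_xy; lra.
  - by apply: derivable_within_continuous => z; rewrite in_itv; exact: df_xy.
  - by rewrite fx fy.
  rewrite in_itv /= => /andP[xc cy] dc.
  have Cc : C c by split=> //; rewrite /= in_itv /=; apply/andP; split; lra.
  apply: fproper_ltn_card; rewrite fproperE; apply/andP; split.
    by apply/fsubsetP => z; rewrite !inE /= => /andP[-> zx]; exact: lt_trans xy.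
  apply/fsubsetPn; exists c; rewrite !inE /= in_fset_set// mem_set//.
  by rewrite [c < x]lt_gtF.
apply: (card_le_finite (B := `I_(#|` fset_set C|).+1)) => //.
apply: (card_le_inj (f := fun x => #|` below x|)).
  move=> x y; rewrite !inE => Ax Ay bxy.
  case: (ltgtP x y) => // [/(below_lt _ _ Ax Ay)|/(below_lt _ _ Ay Ax)];
  by rewrite bxy ltnn.
move=> _ [x _ <-]; rewrite /= ltnS; apply/fsubset_leq_card/fsubsetP => c.
by rewrite !inE => /andP[].
Qed.

Lemma finite_cos_eq0 a b : finite_set (`[a, b] `&` [set x : R | cos x = 0]).
Proof.
apply: (finite_separated_set (pi_gt0 R) (_ : _ `<=` `[a, b])) => [x []//|x y].
move=> [_ cx] [_ cy] xy; apply/eqP; rewrite -subr_eq0; apply/eqP.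
by apply: sin_eq0_small => //; rewrite sinB cx cy mulr0 mul0r subrr.
Qed.

Lemma finite_cos_comp_eq0 f a b : a <= b ->
  (forall x, x \in `[a, b] -> derivable f x 1) ->
  finite_set (`]a, b[ `&` [set c : R | is_derive c 1 f 0]) ->
  finite_set (`[a, b] `&` [set x | cos (f x) = 0]).
Proof.
move=> ab df finC.
have cf : {within `[a, b], continuous f} by exact: derivable_within_continuous.
have [c _ f_le] := EVT_max ab cf; have [d _ f_ge] := EVT_min ab cf.
pose V := `[f d, f c] `&` [set v : R | cos v = 0].
apply: (sub_finite_set (B := \bigcup_(v in V) (`[a, b] `&` [set x | f x = v]))).
  move=> x [xab cfx]; exists (f x) => //; split=> //=.
  by rewrite in_itv /= f_ge ?f_le.
apply: bigcup_finite => [|v _]; first exact: finite_cos_eq0.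
exact: finite_level_set.
Qed.

Lemma cos_eq0_half_period x : exists2 y, y \in `[x, x + pi[ & cos y = 0.
Proof.
have pi0 := pi_gt0 R.
have [cx|cx] := eqVneq (cos x) 0; first by exists x; rewrite ?in_itv /= ?lexx; lra.
have [|||y + cy] := @IVT R cos x (x + pi) 0.
- by lra.
- by apply: continuous_subspaceT => z; exact: continuous_cos.
- by rewrite cosDpi ge_min le_max !oppr_le0 oppr_ge0 orbC; case: leP => // /ltW->.
rewrite in_itv /= => /andP[xy yx]; exists y => //; rewrite in_itv /= xy /=.
rewrite lt_neqAle yx andbT; apply: contra_neq cx => yE.
by move: cy; rewrite yE cosDpi => /eqP; rewrite oppr_eq0 => /eqP.
Qed.

Lemma card_cos_comp_eq0_ge f a b n : a <= b ->
  {within `[a, b], continuous f} -> f b = f a + pi *+ n ->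
  `I_n #<= (`[a, b[ `&` [set x | cos (f x) = 0]).
Proof.
move=> ab cf fab; have pi0 := pi_gt0 R.
have [y + cy] := cos_eq0_half_period (f a); rewrite in_itv /= => /andP[fay yfa].
have /choice[T TP] : forall j : nat, exists x, (j < n)%N ->
    (x \in `[a, b[) /\ f x = y + pi *+ j.
  move=> j; have [jn|] := ltnP j n; last by exists a.
  have j0 : 0 <= pi *+ j :> R by rewrite mulrn_wge0// ltW.
  have yjb : y + pi *+ j < f b.
    have : pi *+ j.+1 <= pi *+ n :> R by rewrite ler_pMn2l.
    by rewrite fab mulrS; lra.
  have [||x + fx] := @IVT R f a b (y + pi *+ j) ab => //.
    by rewrite ge_min le_max (ltW yjb) orbT andbT; apply/orP; left; lra.
  rewrite in_itv /= => /andP[ax xb]; exists x => _; rewrite in_itv /= ax.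
  rewrite lt_neqAle xb andbT; split=> //; apply: contraTneq yjb => <-.
  by rewrite fx ltxx.
apply: (card_le_inj (f := T)) => [i j|_ [j /TP[xab fx] <-]].
  rewrite !inE /= => /TP[_ fi] /TP[_ fj] Tij.
  by move: fj; rewrite -Tij fi => /addrI /(mulrIn (lt0r_neq0 pi0)).
by split=> //=; rewrite fx (alternatingn (@cosDpi R)) cy mulr0.
Qed.

End ZerosOfCosComp.

Section ComplexDerivative.
Variable R : realType.
Implicit Types (f g : R -> R[i]) (h : R -> R) (t : R) (df dg w z : R[i]).

Lemma is_derive_mull (c t : R) : is_derive t 1 ( *%R c) c.
Proof.
have := @is_deriveZ R R^o R^o id c t 1 1 (is_derive_id _ _).
by rewrite /GRing.scale /= mulr1.
Qed.

Lemma is_derive_cvg_quotient h t (dh : R) : is_derive t 1 h dh ->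
  (h (t + e) - h t) / e @[e --> (0 : R)^'] --> dh.
Proof.
move=> [hdh <-]; apply: cvg_trans hdh.
apply: near_eq_cvg; apply: nearW => e.
by rewrite /= /GRing.scale /= mulr1 [e + t]addrC mulrC.
Qed.

Lemma ReD w z : complex.Re (w + z) = complex.Re w + complex.Re z.
Proof. by case: w z => [? ?] [? ?]. Qed.

Lemma ImD w z : complex.Im (w + z) = complex.Im w + complex.Im z.
Proof. by case: w z => [? ?] [? ?]. Qed.

Lemma ReM w z : complex.Re (w * z) =
  complex.Re w * complex.Re z - complex.Im w * complex.Im z.
Proof. by case: w z => [? ?] [? ?]. Qed.

Lemma ImM w z : complex.Im (w * z) =
  complex.Re w * complex.Im z + complex.Im w * complex.Re z.
Proof. by case: w z => [? ?] [? ?]. Qed.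

Definition is_derive_ReIm f t df :=
  is_derive t 1 (@complex.Re R \o f) (complex.Re df) /\
  is_derive t 1 (@complex.Im R \o f) (complex.Im df).

Lemma is_derive_ReIm_eq f t df dg :
  is_derive_ReIm f t df -> df = dg -> is_derive_ReIm f t dg.
Proof. by move=> ? <-. Qed.

Lemma is_derive_ReIm_cst z t : is_derive_ReIm (fun=> z) t 0.
Proof. by split; exact: is_derive_cst. Qed.

Lemma is_derive_ReIm_real h t (dh : R) :
  is_derive t 1 h dh -> is_derive_ReIm (fun s => (h s)%:C) t dh%:C.
Proof. by split=> //; exact: is_derive_cst. Qed.

Lemma is_derive_ReImD f g t df dg : is_derive_ReIm f t df ->
  is_derive_ReIm g t dg -> is_derive_ReIm (fun s => f s + g s) t (df + dg).
Proof.
move=> [Ref Imf] [Reg Img]; split.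
- have -> : @complex.Re R \o (fun s => f s + g s) =
      (@complex.Re R \o f) + (@complex.Re R \o g).
    by apply/funext => s; exact: ReD.
  by rewrite ReD; exact: is_deriveD.
- have -> : @complex.Im R \o (fun s => f s + g s) =
      (@complex.Im R \o f) + (@complex.Im R \o g).
    by apply/funext => s; exact: ImD.
  by rewrite ImD; exact: is_deriveD.
Qed.

Lemma is_derive_ReImM f g t df dg : is_derive_ReIm f t df ->
  is_derive_ReIm g t dg ->
  is_derive_ReIm (fun s => f s * g s) t (df * g t + f t * dg).
Proof.
move=> [Ref Imf] [Reg Img]; split.
- have -> : @complex.Re R \o (fun s => f s * g s) =
      (@complex.Re R \o f) * (@complex.Re R \o g)
      - (@complex.Im R \o f) * (@complex.Im R \o g).
    by apply/funext => s; exact: ReM.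
  apply: is_derive_eq (is_deriveB (is_deriveM Ref Reg) (is_deriveM Imf Img)) _.
  by rewrite ReD !ReM /GRing.scale /=; ring.
- have -> : @complex.Im R \o (fun s => f s * g s) =
      (@complex.Re R \o f) * (@complex.Im R \o g)
      + (@complex.Im R \o f) * (@complex.Re R \o g).
    by apply/funext => s; exact: ImM.
  apply: is_derive_eq (is_deriveD (is_deriveM Ref Img) (is_deriveM Imf Reg)) _.
  by rewrite ImD !ImM /GRing.scale /=; ring.
Qed.

Lemma is_derive_ReIm_comp f h t df (dh : R) :
  is_derive_ReIm f (h t) df -> is_derive t 1 h dh ->
  is_derive_ReIm (f \o h) t (dh%:C * df).
Proof.
move=> [Ref Imf] hdh; split.
- apply: is_derive_eq (is_derive1_comp Ref hdh) _.
  by case: df {Ref Imf} => a b; rewrite /= mul0r subr0 mulrC.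
- apply: is_derive_eq (is_derive1_comp Imf hdh) _.
  by case: df {Ref Imf} => a b; rewrite /= mul0r addr0 mulrC.
Qed.

Lemma is_derive_ReIm_cis t : is_derive_ReIm (@cis R) t ('i * cis t).
Proof.
split; rewrite /= ?(mul0r, mul1r, sub0r, add0r).
  exact: is_derive_cos.
exact: is_derive_sin.
Qed.

Lemma is_derive_ReIm_horner_cis (p : {poly R[i]}) t :
  is_derive_ReIm (fun s => p.[cis s]) t ('i * cis t * p^`().[cis t]).
Proof.
elim/poly_ind: p => [|p c IHp].
  under eq_fun do rewrite horner0.
  by rewrite deriv0 horner0 mulr0; exact: is_derive_ReIm_cst.
under eq_fun do rewrite hornerMXaddC.
apply: is_derive_ReIm_eq.
  apply: is_derive_ReImD (is_derive_ReIm_cst c t).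
  exact: is_derive_ReImM IHp (is_derive_ReIm_cis t).
by rewrite derivMXaddC hornerD hornerMX; ring.
Qed.

Lemma continuous_real_complex : continuous (fun x : R => x%:C : R[i]^o).
Proof.
move=> x; apply/cvgrPdist_lt => e; rewrite ltcE /= => /andP[/eqP e_im e_re].
near=> y; rewrite -rmorphB normc_def /= expr0n addr0 sqrtr_sqr.
rewrite ltcE /= e_im eqxx /=; near: y.
exact: (nbhsx_ballx x _ e_re).
Unshelve. all: by end_near. Qed.

Lemma is_derive_ReIm_is_deriv_R f t df :
  is_derive_ReIm f t df -> is_deriv_R f t df.
Proof.
have cvg_quotient h dh : is_derive t 1 h dh ->
    (((h (t + e) - h t) / e)%:C : R[i]^o) @[e --> (0 : R)^'] --> (dh%:C : R[i]^o).
  move=> /is_derive_cvg_quotient; apply: continuous_cvg.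
  exact: continuous_real_complex.
move=> [/cvg_quotient Ref /cvg_quotient Imf].
rewrite /is_deriv_R [df]complexE.
apply: cvg_trans; last first.
  apply: (@cvgD _ R[i]^o _ _ _ _ _ _ _ Ref).
  exact: (@cvgMl_tmp R[i] _ _ _ _ 'i%C _ Imf).
apply: near_eq_cvg; apply: nearW => e; rewrite !fctE /= -fmorphV.
by case: (f (t + e)) (f t) => [a b] [a' b']; simpc; congr (_ +i* _); ring.
Qed.

End ComplexDerivative.

Section RealPartOnCircle.
Variable R : realType.
Implicit Types (n : nat) (s : {poly R[i]}) (w : R[i]).

(* On the unit circle [conj w = w^-1], so that multiplying
   [2 Re s(w) = s(w) + conj (s(w))] by [w ^ n] yields a polynomial in [w]. *)
Definition re_circle_poly n s : {poly R[i]} :=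
  'X^n * s + \poly_(k < n.+1) (s`_(n - k))^*%C.

Lemma horner_re_circle_poly n s w : (size s <= n.+1)%N -> `|w| = 1 ->
  (re_circle_poly n s).[w] = w ^+ n * (2 * complex.Re s.[w])%:C.
Proof.
move=> sn w1; have wJw : w * w^*%C = 1 by rewrite -sqr_normc w1 expr1n.
rewrite rmorphM rmorph_nat -addcJ mulrDr /re_circle_poly hornerD hornerM hornerXn.
congr (_ + _); rewrite horner_poly (horner_coef_wide _ sn) rmorph_sum mulr_sumr.
rewrite (reindex_inj rev_ord_inj); apply: eq_bigr => /= k _.
have kn : (k <= n)%N by rewrite -ltnS.
rewrite subSS subKn// (rmorphM (@conjc R)) (rmorphXn (@conjc R)) [RHS]mulrCA.
congr (_ * _).
by rewrite -[X in w ^+ X * _](subnK kn) exprD -mulrA -exprMn wJw expr1n mulr1.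
Qed.

Lemma size_re_circle_poly n s : (size s <= n.+1)%N ->
  (size (re_circle_poly n s) <= (2 * n).+1)%N.
Proof.
move=> sn; apply: leq_trans (size_polyD _ _) _; rewrite geq_max; apply/andP; split.
  apply: leq_trans (size_polyMleq _ _) _.
  by rewrite size_polyXn addSn /= mul2n -addnn -addnS leq_add2l.
by apply: leq_trans (size_poly _ _) _; rewrite ltnS leq_pmull.
Qed.

Lemma re_circle_poly_neq0 n s : complex.Re s`_0 != 0 -> re_circle_poly n s != 0.
Proof.
apply: contra_neq => /(congr1 (fun p : {poly R[i]} => p`_n)).
rewrite coef0 coefD coefXnM coef_poly ltnn ltnSn subnn addcJ => /eqP.
by rewrite mulf_eq0 pnatr_eq0 fmorph_eq0 => /eqP.
Qed.

Lemma card_re_horner_circle_eq0_le n s :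
    (size s <= n.+1)%N -> complex.Re s`_0 != 0 ->
  [set w | `|w| = 1 /\ complex.Re s.[w] = 0] #<= `I_(2 * n).
Proof.
move=> sn s0; have p0 := re_circle_poly_neq0 n s0.
apply: (card_le_trans (B := [set w | root (re_circle_poly n s) w])).
  apply: subset_card_le => w [w1 sw] /=.
  by rewrite /root horner_re_circle_poly// sw mulr0 mulr0.
apply: card_le_trans (card_roots_le p0) _; rewrite card_le_II.
by rewrite -ltnS prednK ?size_poly_gt0// size_re_circle_poly.
Qed.

End RealPartOnCircle.

Section SelfdualExp.
Variables (R : realType) (p : {poly R[i]}) (g : nat).
Implicit Types (x : R) (w : R[i]).

Definition selfdual_exp w : R[i] :=
  2^-1 * (cexp p.[w] + (w ^+ 2) ^+ g * (cexp p.[w])^*%C).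

Definition phase x : R := g%:R * x - complex.Im p.[cis x].

Definition dphase_poly : {poly R[i]} := g%:R%:C%:P - 'X * p^`().

Definition critical_points : set R[i] :=
  [set w | `|w| = 1 /\ complex.Re dphase_poly.[w] = 0].

Lemma size_dphase_poly n : (size p <= n.+1)%N -> (size dphase_poly <= n.+1)%N.
Proof.
move=> pn; apply: leq_trans (size_polyD _ _) _; rewrite geq_max size_polyN.
rewrite (leq_trans (size_polyC_leq1 _))//=.
have [->|p0] := eqVneq p 0; first by rewrite deriv0 mulr0 size_poly0.
rewrite mulrC; apply: leq_trans (size_polyMleq _ _) _.
by rewrite size_polyX addn2 /=; apply: leq_trans pn; rewrite lt_size_deriv.
Qed.

Lemma coef0_dphase_poly : dphase_poly`_0 = g%:R%:C.
Proof. by rewrite coefB coefC coefXM subr0. Qed.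

Lemma is_derive_phase x : is_derive x 1 phase (complex.Re dphase_poly.[cis x]).
Proof.
have [_ Imp] := is_derive_ReIm_horner_cis p x.
apply: is_derive_eq (is_deriveB (is_derive_mull g%:R x) Imp) _.
rewrite hornerD hornerN hornerM hornerX hornerC -mulrA [_ * (_ * _)]mulrC ImiRe.
by case: (cis x * _).
Qed.

Lemma derivable_phase x : derivable phase x 1.
Proof. by case: (is_derive_phase x). Qed.

Lemma phase_period : phase (2 * pi) = phase 0 + pi *+ (2 * g).
Proof. by rewrite /phase cis2pi cis0 mulr0 -(mulr_natr pi) natrM; ring. Qed.

Lemma selfdual_exp_cis x : selfdual_exp (cis x) =
  cis (g%:R * x) * (expR (complex.Re p.[cis x]) * cos (phase x))%:C.
Proof.
rewrite /selfdual_exp cexpE; set r := expR _; set y := complex.Im _.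
have -> : (r%:C * cis y)^*%C = r%:C * cis (- y).
  by rewrite rmorphM /= oppr0 /cis cosN sinN.
have y_split : cis y = cis (g%:R * x) * cis (- phase x).
  by rewrite -cisD /phase -/y; congr cis; ring.
have yJ_split : (cis x ^+ 2) ^+ g * cis (- y) = cis (g%:R * x) * cis (phase x).
  by rewrite exprAC -cisMn expr2 -mulrA -!cisD /phase -/y; congr cis; ring.
rewrite [_ * (r%:C * _)]mulrCA yJ_split y_split -!mulrDr addrC addr_cisN.
by rewrite !rmorphM rmorph_nat /=; field.
Qed.

Lemma selfdual_exp_cis_eq0 x : selfdual_exp (cis x) = 0 <-> cos (phase x) = 0.
Proof.
rewrite selfdual_exp_cis; split=> [/eqP|->]; last by rewrite mulr0 mulr0.
rewrite mulf_eq0 (negbTE (cis_neq0 _)) fmorph_eq0 mulf_eq0.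
by rewrite gt_eqF ?expR_gt0// => /eqP.
Qed.

Lemma is_derive_selfdual_exp_cis x : cos (phase x) = 0 ->
  is_derive_ReIm (selfdual_exp \o cis) x
    (- (cis (g%:R * x) * (expR (complex.Re p.[cis x]) * sin (phase x)
        * complex.Re dphase_poly.[cis x])%:C)).
Proof.
move=> cx.
have [Rep _] := is_derive_ReIm_horner_cis p x.
have dexp := is_derive1_comp (is_derive_expR _) Rep.
have dcos := is_derive1_comp (is_derive_cos _) (is_derive_phase x).
have damp := is_derive_ReIm_real (is_deriveM dexp dcos).
have dcis :=
  is_derive_ReIm_comp (is_derive_ReIm_cis (g%:R * x)) (is_derive_mull g%:R x).
have -> : selfdual_exp \o cis = fun s => cis (g%:R * s) *
    (expR (complex.Re p.[cis s]) * cos (phase s))%:C.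
  by apply/funext => s; exact: selfdual_exp_cis.
apply: is_derive_ReIm_eq (is_derive_ReImM dcis damp) _.
rewrite /= !fctE /= cx mulr0 rmorph0 mulr0 add0r scale0r addr0 -mulrN -rmorphN.
by congr (_ * _%:C); rewrite /GRing.scale /=; ring.
Qed.

Lemma selfdual_exp_cis_simple x : cos (phase x) = 0 ->
  complex.Re dphase_poly.[cis x] != 0 ->
  exists2 l, l != 0 & is_derive_ReIm (selfdual_exp \o cis) x l.
Proof.
move=> cx phase'0; eexists; last exact: is_derive_selfdual_exp_cis.
rewrite oppr_eq0 mulf_neq0 ?cis_neq0// fmorph_eq0 !mulf_neq0//.
  by rewrite gt_eqF ?expR_gt0.
apply/eqP => sx; have := cos2Dsin2 (phase x).
by rewrite cx sx expr0n addr0 => /eqP; rewrite eq_sym oner_eq0.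
Qed.

Hypothesis g_gt0 : (0 < g)%N.

Lemma selfdual_exp_eq0_norm w : selfdual_exp w = 0 -> `|w| = 1.
Proof.
move=> /eqP; rewrite /selfdual_exp mulf_eq0 invr_eq0 pnatr_eq0 orFb.
move: (cexp _) (cexp_neq0 p.[w]) => z z0; rewrite addr_eq0 => /eqP zE.
have /mulIf : 1 * `|z| = `|w ^+ 2 ^+ g| * `|z|.
  by rewrite mul1r [LHS](congr1 _ zE) normrN normrM normcJ.
rewrite normr_eq0 => /(_ z0)/esym/eqP.
by rewrite !normrX !pexpr_eq1// => /eqP.
Qed.

Lemma selfdual_exp_zerosE :
  [set w | selfdual_exp w = 0] =
  cis @` (`[0, 2 * pi[ `&` [set x | cos (phase x) = 0]).
Proof.
apply/seteqP; split=> [w /= w0|_ [x [_ cx] <-]]; last exact/selfdual_exp_cis_eq0.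
have [x x2pi wE] := unit_circle_cis (selfdual_exp_eq0_norm w0).
by exists x => //; split => //; apply/selfdual_exp_cis_eq0; rewrite -wE.
Qed.

Lemma card_critical_points_le n :
  (size p <= n.+1)%N -> critical_points #<= `I_(2 * n).
Proof.
move=> pn; apply: card_re_horner_circle_eq0_le; first exact: size_dphase_poly.
by rewrite coef0_dphase_poly pnatr_eq0 -lt0n.
Qed.

Lemma finite_phase_critical :
  finite_set (`]0, 2 * pi[ `&` [set x : R | is_derive x 1 phase 0]).
Proof.
have := card_critical_points_le (leqnSn (size p)).
move=> /card_le_finite/(_ (finite_II _)); apply: card_le_finite.
apply: (card_le_inj (f := cis)) => [x y|_ [x [_ dx] <-]].
  rewrite !inE => -[+ _] [+ _]; rewrite /= !in_itv /= => /andP[x0 x2] /andP[y0 y2].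
  by apply: cis_inj; rewrite in_itv /= ltW.
split; first exact: norm_cis.
by have [_ <-] := is_derive_phase x; case: dx.
Qed.

Lemma finite_selfdual_exp_zeros : finite_set [set w | selfdual_exp w = 0].
Proof.
rewrite selfdual_exp_zerosE; apply: finite_image.
have pi2_ge0 : 0 <= 2 * pi :> R by rewrite mulr_ge0 ?pi_ge0.
have := finite_cos_comp_eq0 pi2_ge0 (fun x _ => @derivable_phase x)
  finite_phase_critical.
apply: sub_finite_set => x [+ cx]; rewrite /= !in_itv /= => /andP[x0 x2].
by split; rewrite //= x0 ltW.
Qed.

Lemma card_selfdual_exp_zeros_ge : `I_(2 * g) #<= [set w | selfdual_exp w = 0].
Proof.
rewrite selfdual_exp_zerosE.
rewrite (card_le_eqr (inj_card_eq _)); last first.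
  by move=> x y; rewrite !inE => -[x2 _] [y2 _]; exact: cis_inj.
apply: card_cos_comp_eq0_ge.
- by rewrite mulr_ge0 ?pi_ge0.
- by apply: derivable_within_continuous => x _; exact: derivable_phase.
- exact: phase_period.
Qed.

End SelfdualExp.

Section ZerosOfFK.
Variables (R : realType) (F : finFieldType) (K g : nat) (D : {poly F}).
Implicit Types (t : R) (u : R[i]).

Let r : R := Num.sqrt #|F|%:R.

Let r_gt0 : 0 < r.
Proof. by rewrite sqrtr_gt0 ltr0n; apply/card_gt0P; exists 0. Qed.

Let rC_neq0 : r%:C != 0.
Proof. by rewrite fmorph_eq0 (gt_eqF r_gt0). Qed.

Let sqr_rC : r%:C ^+ 2 = #|F|%:R.
Proof. by rewrite -rmorphXn sqr_sqrtr// rmorph_nat. Qed.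

Definition log_coef k : R :=
  \sum_(f : {poly_k.+1 F} | ((f : {poly F}) \is monic) && (size f == k.+1))
    (mangoldt f)%:R * (jacobi D f)%:~R / k%:R.

Lemma PK_log_coef u :
  PK K D u = cexp (\sum_(1 <= k < K.+1) (log_coef k)%:C * u ^+ k).
Proof.
congr cexp; apply: eq_bigr => k _.
rewrite rmorph_sum mulr_suml; apply: eq_bigr => f _.
by rewrite !(rmorphM, fmorphV, rmorph_nat, rmorph_int) /= mulrAC.
Qed.

Lemma PK_conj u : PK K D u^*%C = (PK K D u)^*%C.
Proof.
rewrite !PK_log_coef -cexpJ rmorph_sum; congr cexp; apply: eq_bigr => k _.
by rewrite rmorphM rmorphXn /= oppr0.
Qed.

Definition log_poly : {poly R[i]} :=
  \sum_(1 <= k < K.+1) (log_coef k / r ^+ k)%:C *: 'X^k.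

Lemma size_log_poly : (size log_poly <= K.+1)%N.
Proof.
apply: leq_trans (size_sum _ _ _) _; rewrite big_nat_cond.
apply/bigmax_leqP_seq => k _ /andP[/andP[_ kK] _].
by apply: leq_trans (size_scale_leq _ _) _; rewrite size_polyXn.
Qed.

Lemma PK_log_poly u : PK K D u = cexp log_poly.[r%:C * u].
Proof.
rewrite PK_log_coef horner_sum; congr cexp; apply: eq_bigr => k _.
rewrite hornerZ hornerXn exprMn -rmorphXn mulrA -rmorphM divfK//.
by rewrite expf_neq0// (gt_eqF r_gt0).
Qed.

Lemma FK_selfdual_exp u : FK K g D u = selfdual_exp log_poly g (r%:C * u).
Proof.
by rewrite /FK /selfdual_exp PK_conj PK_log_poly [(_ * u) ^+ 2]exprMn sqr_rC.
Qed.

Lemma zerosE : zeros R K g D =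
  *%R r%:C^-1 @` [set w | selfdual_exp log_poly g w = 0].
Proof.
apply/seteqP; split=> [u|_ [w w0 <-]]; rewrite /zeros /= FK_selfdual_exp ?mulVKf//.
by move=> u0; exists (r%:C * u); rewrite ?mulKf.
Qed.

Lemma circle_ptE t : circle_pt F t = r%:C^-1 * cis (2 * pi * t).
Proof. by rewrite /circle_pt e2piE fmorphV. Qed.

Hypothesis g_gt0 : (0 < g)%N.

Lemma finite_zeros : finite_set (zeros R K g D).
Proof. by rewrite zerosE; exact/finite_image/finite_selfdual_exp_zeros. Qed.

Lemma card_zeros_ge : (2 * g <= #|` fset_set (zeros R K g D)|)%N.
Proof.
apply: leq_card_fset_set; first exact: finite_zeros.
rewrite zerosE (card_le_eqr (inj_card_eq _)).
  exact: card_selfdual_exp_zeros_ge.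
by apply: in2W; apply: mulfI; rewrite invr_eq0.
Qed.

Lemma simple_zeros_cis x : selfdual_exp log_poly g (cis x) = 0 ->
  complex.Re (dphase_poly log_poly g).[cis x] != 0 ->
  simple_zeros R K g D (r%:C^-1 * cis x).
Proof.
move=> w0 phase'0; split; first by rewrite /zeros /= FK_selfdual_exp mulVKf.
have /selfdual_exp_cis_eq0 cx := w0.
have [l l0 dl] := selfdual_exp_cis_simple cx phase'0.
have pi2_neq0 : 2 * pi != 0 :> R by rewrite mulf_neq0// gt_eqF ?pi_gt0.
have xE : 2 * pi * (x / (2 * pi)) = x by rewrite mulrC divfK.
exists (x / (2 * pi)), ((2 * pi)%:C * l); split; first by rewrite circle_ptE xE.
- have -> : FK K g D \o circle_pt F =
      selfdual_exp log_poly g \o cis \o (fun t => 2 * pi * t).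
    by apply/funext => t; rewrite /= FK_selfdual_exp circle_ptE mulVKf.
  rewrite -xE in dl; apply: is_derive_ReIm_is_deriv_R.
  exact: is_derive_ReIm_comp dl (is_derive_mull _ _).
- by rewrite mulf_neq0// fmorph_eq0.
Qed.

Lemma multiple_zeros_critical u :
  multiple_zeros R K g D u -> critical_points log_poly g (r%:C * u).
Proof.
move=> [zu nsimple]; have := zu; rewrite /zeros /= FK_selfdual_exp => w0.
have w1 := selfdual_exp_eq0_norm g_gt0 w0; split=> //.
have [x _ wE] := unit_circle_cis w1; rewrite wE in w0 *.
apply/eqP/negPn/negP => phase'0; apply: nsimple.
by rewrite -[u](mulKf rC_neq0) wE; exact: simple_zeros_cis.
Qed.

Lemma card_multiple_zeros_le :
  (#|` fset_set (multiple_zeros R K g D)| <= 2 * K)%N.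
Proof.
apply: geq_card_fset_set.
apply: card_le_trans (card_critical_points_le g_gt0 size_log_poly).
apply: (card_le_inj (f := *%R r%:C)); first by apply: in2W; exact: mulfI.
by move=> _ [u mu <-]; exact: multiple_zeros_critical.
Qed.

End ZerosOfFK.

Theorem theorem17 (R : realType) (F : finFieldType) (K : nat -> nat)
    (oddq : odd #|F|)
    (K_ge : \forall g \near \oo,
       ln (g%:R : R) * (ln (g%:R : R) / ln (#|F|%:R : R)) <= (K g)%:R)
    (K_o : (K g)%:R / g%:R @[g --> \oo] --> (0 : R)) :
  exists delta eta : nat -> R,
    [/\ delta @ \oo --> (0 : R),
        eta @ \oo --> (0 : R) &
        \forall g \near \oo, forall D : {poly F},
          D \is monic -> squarefree_poly D -> size D = ((2 * g + 1).+1)%N ->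
          [/\ finite_set (zeros R (K g) g D),
              (2 * g%:R * (1 + delta g)
                 <= #|` fset_set (zeros R (K g) g D)|%:R)%R &
              (#|` fset_set (multiple_zeros R (K g) g D)|%:R
                 <= eta g * g%:R)%R]].
Proof.
exists (fun=> 0), (fun g => 2 * ((K g)%:R / g%:R)); split; first exact: cvg_cst.
  by rewrite -(mulr0 2); exact: cvgMl_tmp.
near=> g => D _ _ _.
have g_gt0 : (0 < g)%N by near: g; exact: nbhs_infty_gt.
split; first exact: finite_zeros.
  by rewrite addr0 mulr1 -natrM ler_nat; exact: card_zeros_ge.
rewrite -mulrA divfK ?pnatr_eq0 -?lt0n// -natrM ler_nat.
exact: card_multiple_zeros_le.
Unshelve. all: by end_near. Qed.
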